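(* Let $a,b\in\mathbb{N}$ be such that $\mathcal{A}=\left(\frac{-a,-b}{\mathbb{Q}}\right)$ is a division algebra, and let $H$ be an order in $\mathcal{A}$ with $\mathbb{Z}$-basis $\{1,v_1,v_2,v_3\}$, where $v_r=a_{r,0}+a_{r,1}i+a_{r,2}j+a_{r,3}k$ for $r=1,2,3$. Let $d=(1+a)(1+b)$ and $M=\max_{1\le r\le3,\,0\le s\le3}|a_{r,s}|$. Then $H$ is a left principal ideal domain if and only if $\frac{\delta}{p}\in\mathcal{S}_H$ for every prime $p<\lceil 2M(1+\sqrt{1+3d})\rceil^3$ and every nonzero $\delta=d_0+d_1v_1+d_2v_2+d_3v_3$ with $d_0,\dots,d_3\in\mathbb{Z}$, $d_0\ge0$, $|d_i|\le\frac{p}{2}$ for all $i$, and $p\mid\mathrm{N}(\delta)$.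
   Context: $\mathcal{A}$ has $\mathbb{Q}$-basis $1,i,j,k$ with $i^2=-a$, $j^2=-b$, $k=ij=-ji$, and norm $\mathrm{N}(x_0+x_1i+x_2j+x_3k)=x_0^2+ax_1^2+bx_2^2+abx_3^2$. An order is a subring containing $1$ that is a finitely generated $\mathbb{Z}$-module spanning $\mathcal{A}$ over $\mathbb{Q}$; a left principal ideal domain is one in which every left ideal is of the form $H\gamma$. Define $\mathcal{D}_{\mathcal{A}}=\{\rho\in\mathcal{A}: 0<\mathrm{N}(\rho)<1\}$ and $\mathcal{S}_H=\{\rho\in\mathcal{A}\setminus H:\ \exists\,\alpha,\beta\in H,\ \alpha\rho-\beta\in\mathcal{D}_{\mathcal{A}}\}$. *)

(* Defs.v *)
From HB Require Import structures.
From mathcomp Require Import all_boot all_order all_algebra.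
From mathcomp Require Import ring.
From mathcomp Require Import realalg.
From mathcomp Require Import classical_sets.

Set Implicit Arguments.
Unset Strict Implicit.
Unset Printing Implicit Defensive.
Import Order.TTheory GRing.Theory Num.Theory.
Local Open Scope ring_scope.
Local Open Scope classical_set_scope.

(* [quat a b] is the quaternion algebra (-a, -b / Q): [Quat x0 x1 x2 x3] stands
   for x0 + x1 i + x2 j + x3 k with i^2 = -a, j^2 = -b and k = ij = -ji. *)
Record quat (a b : nat) := Quat {
  q0 : rat; q1 : rat; q2 : rat; q3 : rat
}.

Section QuaternionAlgebra.
Variables a b : nat.
Notation A := (quat a b).
Notation Q := (@Quat a b).
Implicit Types x y z : A.

Definition quat_tuple x := (q0 x, q1 x, q2 x, q3 x).
Definition tuple_quat (t : rat * rat * rat * rat) : A :=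
  let: (x0, x1, x2, x3) := t in Q x0 x1 x2 x3.

Lemma quat_tupleK : cancel quat_tuple tuple_quat.
Proof. by case. Qed.

HB.instance Definition _ := Choice.copy A (can_type quat_tupleK).

Definition addq x y :=
  Q (q0 x + q0 y) (q1 x + q1 y) (q2 x + q2 y) (q3 x + q3 y).
Definition oppq x := Q (- q0 x) (- q1 x) (- q2 x) (- q3 x).

Lemma addqA : associative addq.
Proof. by move=> [? ? ? ?] [? ? ? ?] [? ? ? ?]; rewrite /addq /= !addrA. Qed.
Lemma addqC : commutative addq.
Proof.
by move=> [x0 x1 x2 x3] [? ? ? ?]; congr Quat => /=; rewrite addrC.
Qed.
Lemma add0q : left_id (Q 0 0 0 0) addq.
Proof. by move=> [? ? ? ?]; rewrite /addq /= !add0r. Qed.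
Lemma addNq : left_inverse (Q 0 0 0 0) oppq addq.
Proof. by move=> [? ? ? ?]; rewrite /addq /= !addNr. Qed.

HB.instance Definition _ := GRing.isZmodule.Build A addqA addqC add0q addNq.

Definition mulq x y :=
  let: Quat x0 x1 x2 x3 := x in let: Quat y0 y1 y2 y3 := y in
  Q (x0 * y0 - a%:R * (x1 * y1) - b%:R * (x2 * y2) - a%:R * b%:R * (x3 * y3))
    (x0 * y1 + x1 * y0 + b%:R * (x2 * y3 - x3 * y2))
    (x0 * y2 + x2 * y0 + a%:R * (x3 * y1 - x1 * y3))
    (x0 * y3 + x3 * y0 + (x1 * y2 - x2 * y1)).

Lemma mulqA : associative mulq.
Proof.
by move=> [? ? ? ?] [? ? ? ?] [? ? ? ?]; rewrite /mulq; congr Quat; ring.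
Qed.
Lemma mul1q : left_id (Q 1 0 0 0) mulq.
Proof. by move=> [? ? ? ?]; rewrite /mulq; congr Quat; ring. Qed.
Lemma mulq1 : right_id (Q 1 0 0 0) mulq.
Proof. by move=> [? ? ? ?]; rewrite /mulq; congr Quat; ring. Qed.
Lemma mulqDl : left_distributive mulq +%R.
Proof.
by move=> [? ? ? ?] [? ? ? ?] [? ? ? ?]; rewrite /mulq; congr Quat => /=; ring.
Qed.
Lemma mulqDr : right_distributive mulq +%R.
Proof.
by move=> [? ? ? ?] [? ? ? ?] [? ? ? ?]; rewrite /mulq; congr Quat => /=; ring.
Qed.
Lemma oneq_neq0 : Q 1 0 0 0 != 0.
Proof. by apply/eqP => -[]. Qed.

HB.instance Definition _ :=
  GRing.Zmodule_isNzRing.Build A mulqA mul1q mulq1 mulqDl mulqDr oneq_neq0.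

Definition scaleq (c : rat) x := Q (c * q0 x) (c * q1 x) (c * q2 x) (c * q3 x).

Lemma scaleqA c d x : scaleq c (scaleq d x) = scaleq (c * d) x.
Proof. by rewrite /scaleq /= !mulrA. Qed.
Lemma scale1q : left_id 1 scaleq.
Proof. by move=> [? ? ? ?]; rewrite /scaleq /= !mul1r. Qed.
Lemma scaleqDr : right_distributive scaleq +%R.
Proof. by move=> c x y; congr Quat; rewrite /= mulrDr. Qed.
Lemma scaleqDl x : {morph scaleq^~ x : c d / c + d}.
Proof. by move=> c d; congr Quat; rewrite /= mulrDl. Qed.

HB.instance Definition _ :=
  GRing.Zmodule_isLmodule.Build rat A scaleqA scale1q scaleqDr scaleqDl.

Lemma scaleqAl (c : rat) x y : c *: (x * y) = (c *: x) * y.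
Proof. by case: x y => [? ? ? ?] [? ? ? ?]; congr Quat => /=; ring. Qed.
Lemma scaleqAr (c : rat) x y : c *: (x * y) = x * (c *: y).
Proof. by case: x y => [? ? ? ?] [? ? ? ?]; congr Quat => /=; ring. Qed.

HB.instance Definition _ := GRing.Lmodule_isLalgebra.Build rat A scaleqAl.
HB.instance Definition _ := GRing.Lalgebra_isAlgebra.Build rat A scaleqAr.

Definition qi : A := Q 0 1 0 0.
Definition qj : A := Q 0 0 1 0.
Definition qk : A := Q 0 0 0 1.

Lemma qi_sqr : qi * qi = (- a%:R)%:A.
Proof. by congr Quat => /=; ring. Qed.
Lemma qj_sqr : qj * qj = (- b%:R)%:A.
Proof. by congr Quat => /=; ring. Qed.
Lemma qi_qj : qi * qj = qk.
Proof. by congr Quat => /=; ring. Qed.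
Lemma qj_qi : qj * qi = - qk.
Proof. by congr Quat => /=; ring. Qed.
Lemma quatE x : x = (q0 x)%:A + q1 x *: qi + q2 x *: qj + q3 x *: qk.
Proof. by case: x => *; congr Quat => /=; ring. Qed.

Definition qnorm x : rat :=
  q0 x ^+ 2 + a%:R * q1 x ^+ 2 + b%:R * q2 x ^+ 2
  + a%:R * b%:R * q3 x ^+ 2.

End QuaternionAlgebra.

Arguments qi {a b}.
Arguments qj {a b}.
Arguments qk {a b}.

Definition division_ring (R : nzRingType) : Prop :=
  forall x : R, x != 0 -> exists y : R, y * x = 1 /\ x * y = 1.

Definition zcomb (V : zmodType) (n : nat) (e : n.-tuple V) (c : 'I_n -> int) :=
  \sum_(i < n) tnth e i *~ c i.

Definition zspan (V : zmodType) (n : nat) (e : n.-tuple V) : set V :=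
  [set x | exists c : 'I_n -> int, x = zcomb e c].

Definition is_zbasis (V : zmodType) (n : nat) (e : n.-tuple V) (H : set V) :=
  H = zspan e /\
  (forall c : 'I_n -> int, zcomb e c = 0 -> forall i, c i = 0).

Definition is_subring (R : nzRingType) (H : set R) : Prop :=
  [/\ H 1,
      forall x y, H x -> H y -> H (x - y)
    & forall x y, H x -> H y -> H (x * y)].

Definition is_order (L : algType rat) (H : set L) : Prop :=
  [/\ is_subring H,
      exists (n : nat) (e : n.-tuple L), H = zspan e
    & forall x : L, exists (n : nat) (h : n.-tuple L) (c : 'I_n -> rat),
        (forall i, H (tnth h i)) /\ x = \sum_(i < n) c i *: tnth h i].

Definition left_ideal (R : nzRingType) (H I : set R) : Prop :=
  [/\ I `<=` H,
      I 0,
      forall x y, I x -> I y -> I (x - y)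
    & forall h x, H h -> I x -> I (h * x)].

Definition left_pid (R : nzRingType) (H : set R) : Prop :=
  (forall x y, H x -> H y -> x * y = 0 -> x = 0 \/ y = 0) /\
  (forall I : set R, left_ideal H I ->
     exists2 g, H g & I = [set h * g | h in H]).

Definition D_set (a b : nat) : set (quat a b) :=
  [set r | 0 < qnorm r < 1].

Definition S_set (a b : nat) (H : set (quat a b)) : set (quat a b) :=
  [set r | ~ H r /\
     exists alpha beta, [/\ H alpha, H beta & D_set (alpha * r - beta)]].

Definition max_coef (m n : nat) (c : 'M[rat]_(m, n)) : rat :=
  \big[Order.max/0]_(r < m) \big[Order.max/0]_(s < n) `|c r s|.

(* The ceiling of 2M(1 + sqrt(1 + 3d)) is taken in the field of real algebraic
   numbers, which contains this number since M is rational. *)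
Definition prime_bound (M : rat) (d : nat) : int :=
  Num.ceil (2 * ratr M * (1 + Num.sqrt (1 + 3 * d%:R)) : realalg) ^+ 3.

(* Main.v *)
(* This is a Dedekind-Hasse argument. The norm takes integral values on H: if D
   clears the denominators of the coordinates on H, then D^2 N(x)^n is an integer
   for every n. Hence H is a left PID as soon as every rho outside H lies in S_H.
   Multiplying such a rho by an integer and translating by H turns it into
   delta / p with p prime and delta reduced modulo p. If p does not divide
   N(delta), a multiple of conj(delta) and a Bezout relation produce 1 / p. If
   p >= K^3 with K the ceiling in the bound, Dirichlet's simultaneous
   approximation gives 0 < t < p for which the v_1, v_2, v_3 coordinates of
   t delta / p are all within 1 / K of integers, which makes the norm of a
   translate smaller than 1. Conversely, a generator of H delta + H p has norm
   smaller than p^2 unless delta / p lies in H. *)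
Require Import Defs.
From mathcomp Require Import all_boot all_order all_algebra.
From mathcomp Require Import ring lra zify.
From mathcomp Require Import realalg.
From mathcomp Require Import boolp classical_sets.
Import Order.TTheory GRing.Theory Num.Theory.
Set Implicit Arguments.
Unset Strict Implicit.
Unset Printing Implicit Defensive.
Local Open Scope ring_scope.
Local Open Scope classical_set_scope.

(** * Integrality, rounding and Diophantine approximation over the rationals and integers *)

Lemma common_den (I : finType) (f : I -> rat) :
  exists2 D : nat, (0 < D)%N & forall i, D%:R * f i \is a Num.int.
Proof.
exists (\prod_i `|denq (f i)|)%N.
  by apply: prodn_gt0 => i; rewrite absz_gt0 denq_neq0.
move=> i; rewrite (bigD1 i) //= natrM mulrAC natr_absz normr_denq.
by rewrite [_ * f i]mulrC -numqE rpredM ?intr_int ?natr_int.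
Qed.

(** Taking n = D, the D-th power of the reduced denominator of q divides D. A denominator of at
    least 2 would make that power exceed D. *)
Lemma int_of_bounded_den (D : nat) (q : rat) : (0 < D)%N ->
  (forall n, D%:R * q ^+ n \is a Num.int) -> q \is a Num.int.
Proof.
move=> D_gt0 /(_ D) /intrP[m Dq]; have den_gt0 := denq_gt0 q.
have dvdD : (`|denq q| ^ D %| D)%N.
  rewrite -(@Gauss_dvdl _ _ (`|numq q| ^ D)%N); last first.
    by rewrite coprimeXl ?coprimeXr // coprime_sym coprime_num_den.
  apply/dvdnP; exists `|m|%N; rewrite -!abszX.
  suff: D%:Z * numq q ^+ D = m * denq q ^+ D.
    by move/(congr1 absz); rewrite !abszM.
  apply/eqP; rewrite -(eqr_int rat) !rmorphM !rmorphXn /= -Dq -mulrA -exprMn.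
  by rewrite numqE.
rewrite Qint_def; apply/eqP; apply: contraTeq dvdD => den_neq1.
rewrite gtnNdvd // (leq_trans (ltn_expl D (ltnSn 1))) // leq_exp2r //.
by lia.
Qed.

Lemma nearest_multiple (p : nat) (x : int) : (0 < p)%N ->
  exists q : int, `|x - q * p%:Z| * 2 <= p%:Z.
Proof.
(* The witness is the floor of x / p + 1 / 2. *)
move=> p_gt0; exists ((2 * x + p%:Z) %/ (2 * p%:Z))%Z.
have := divz_eq (2 * x + p%:Z) (2 * p%:Z).
have := @ltz_pmod (2 * x + p%:Z) (2 * p%:Z) ltac:(lia).
have := @modz_ge0 (2 * x + p%:Z) (2 * p%:Z) ltac:(lia).
by lia.
Qed.

(** Pigeonhole: the residues of t d modulo p for t = 0, ..., K^n fall into K^n boxes of side p / K.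
    Two values of t share a box, and their difference is the required one. *)
Lemma simultaneous_approximation (n K p : nat) (d : 'I_n -> int) :
  (0 < K)%N -> (0 < p)%N ->
  exists t : nat, [/\ (0 < t)%N, (t <= K ^ n)%N &
    exists q : 'I_n -> int,
      forall i, K%:Z * `|t%:Z * d i - q i * p%:Z| < p%:Z].
Proof.
move=> K_gt0 p_gt0.
pose res (t : nat) i := `|(t%:Z * d i %% p%:Z)%Z|%N.
have res_lt t i : (res t i < p)%N.
  have := @ltz_pmod (t%:Z * d i) p%:Z p_gt0.
  have := @modz_ge0 (t%:Z * d i) p%:Z ltac:(lia).
  by rewrite /res; lia.
have box_lt t i : (K * res t i %/ p < K)%N.
  by rewrite ltn_divLR // ltn_pmul2l.
pose f (t : 'I_(K ^ n).+1) := [ffun i => Ordinal (box_lt t i)].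
have /injectivePn[t1 [t2 t12 eq_f]] : ~~ injectiveb f.
  apply/negP => /injectiveP /leq_card.
  by rewrite card_ffun !card_ord ltnn.
wlog lt12 : t1 t2 t12 eq_f / (t1 < t2)%N.
  move=> th; case: (ltngtP t1 t2) => [|lt21|/val_inj eq12]; first exact: th.
  - by apply: (th t2 t1); rewrite // eq_sym.
  - by rewrite eq12 eqxx in t12.
exists (t2 - t1)%N; split; [by rewrite subn_gt0 | |].
  by rewrite (leq_trans (leq_subr _ _)) // -ltnS.
exists (fun i => ((t2%:Z * d i) %/ p%:Z)%Z - ((t1%:Z * d i) %/ p%:Z)%Z) => i.
have /ffunP/(_ i) := eq_f; rewrite !ffunE => /(congr1 val) /= eq_box.
have E t : t%:Z * d i = (t%:Z * d i %/ p%:Z)%Z * p%:Z + (res t i)%:Z.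
  have := divz_eq (t%:Z * d i) p%:Z.
  have := @modz_ge0 (t%:Z * d i) p%:Z ltac:(lia).
  by rewrite /res; lia.
have -> : (t2 - t1)%:Z * d i -
   ((t2%:Z * d i %/ p%:Z)%Z - (t1%:Z * d i %/ p%:Z)%Z) * p%:Z
   = (res t2 i)%:Z - (res t1 i)%:Z.
  by rewrite -subzn 1?ltnW // mulrBl {1}(E t1) {1}(E t2); ring.
have -> : K%:Z * `|(res t2 i)%:Z - (res t1 i)%:Z|
        = `|(K * res t2 i)%N%:Z - (K * res t1 i)%N%:Z|.
  by rewrite !PoszM -mulrBr normrM.
(* Equal quotients by p force K times the two residues to differ by less than p. *)
have := divn_eq (K * res t1 i) p; have := divn_eq (K * res t2 i) p.
have := ltn_pmod (K * res t1 i) p_gt0; have := ltn_pmod (K * res t2 i) p_gt0.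
by rewrite eq_box; move: (_ %% _)%N (_ %% _)%N (_ %/ _ * _)%N => ? ? ?; lia.
Qed.

(** * Conjugation and the norm form *)

Section QuaternionNorm.
Variables a b : nat.
Implicit Types x y : quat a b.

Definition qconj x : quat a b := Quat _ _ (q0 x) (- q1 x) (- q2 x) (- q3 x).

Lemma qconjE x : qconj x = (2 * q0 x)%:A - x.
Proof. by case: x => *; congr Quat => /=; ring. Qed.

Lemma mul_conjq x : qconj x * x = (qnorm x)%:A.
Proof. by case: x => *; rewrite /qnorm; congr Quat => /=; ring. Qed.

Lemma qnormM x y : qnorm (x * y) = qnorm x * qnorm y.
Proof. by case: x y => ? ? ? ? [? ? ? ?]; rewrite /qnorm /=; ring. Qed.

Lemma qnormZ k x : qnorm (k *: x) = k ^+ 2 * qnorm x.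
Proof. by rewrite /qnorm /=; ring. Qed.

Lemma qnorm1 : qnorm (1 : quat a b) = 1.
Proof. by rewrite /qnorm /=; ring. Qed.

Lemma qnorm0 : qnorm (0 : quat a b) = 0.
Proof. by rewrite /qnorm /=; ring. Qed.

Lemma qnormX x n : qnorm (x ^+ n) = qnorm x ^+ n.
Proof.
by elim: n => [|n IH]; rewrite ?qnorm1 // !exprS qnormM IH.
Qed.

(** Polarisation: integrality of the norm on an order passes to the trace. *)
Lemma qtrace_norm x : 2 * q0 x = qnorm (x + 1) - qnorm x - 1.
Proof. by rewrite /qnorm /=; ring. Qed.

(** The formula is a sum of nonnegative terms, and an inverse y gives N(y) N(x) = 1, so it cannot
    vanish. *)
Lemma qnorm_gt0 x : division_ring (quat a b) -> x != 0 -> 0 < qnorm x.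
Proof.
move=> hdiv x0; have [y [yx _]] := hdiv x x0.
rewrite lt_def; apply/andP; split.
  apply/eqP => Nx; have := congr1 (@qnorm a b) yx.
  by rewrite qnormM Nx mulr0 qnorm1.
by rewrite /qnorm -natrM !addr_ge0 ?(mulr_ge0 (ler0n _ _)) ?sqr_ge0.
Qed.

End QuaternionNorm.

(** * Integer combinations and closure properties of subrings *)

Section ZCombinations.
Variables (V : zmodType) (n : nat) (e : n.-tuple V).
Implicit Types c d : 'I_n -> int.

Lemma zcombB c d : zcomb e (fun i => c i - d i) = zcomb e c - zcomb e d.
Proof. by rewrite /zcomb -sumrB; apply: eq_bigr => i _; rewrite mulrzBr. Qed.

Lemma zcombMz c m : zcomb e (fun i => c i * m) = zcomb e c *~ m.
Proof.
rewrite /zcomb (big_morph ( *~%R^~ m) (mulrzDl_tmp m) (mul0rz _ m)).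
by apply: eq_bigr => i _; rewrite mulrzA.
Qed.

Lemma zcomb_inj H c d : is_zbasis e H ->
  zcomb e c = zcomb e d -> forall i, c i = d i.
Proof.
move=> [_ free] eq_cd i; apply/eqP; rewrite -subr_eq0; apply/eqP.
by apply: (free (fun i => c i - d i)); rewrite zcombB eq_cd subrr.
Qed.

End ZCombinations.

Section Subring.
Variables (R : nzRingType) (H : set R).
Hypothesis hR : is_subring H.

Lemma subring1 : H 1. Proof. by case: hR. Qed.
Lemma subringB x y : H x -> H y -> H (x - y).
Proof. by case: hR => _ + _; apply. Qed.
Lemma subringM x y : H x -> H y -> H (x * y).
Proof. by case: hR => _ _; apply. Qed.
Lemma subring0 : H 0.
Proof. by rewrite -(subrr 1); apply: subringB subring1 subring1. Qed.
Lemma subringN x : H x -> H (- x).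
Proof. by rewrite -sub0r; apply: subringB subring0. Qed.
Lemma subringD x y : H x -> H y -> H (x + y).
Proof. by move=> Hx Hy; rewrite -[y]opprK; apply: subringB (subringN Hy). Qed.
Lemma subringX x n : H x -> H (x ^+ n).
Proof.
by move=> Hx; elim: n => [|n IH]; [exact: subring1|rewrite exprS; exact: subringM].
Qed.
Lemma subring_nat n : H n%:R.
Proof.
by elim: n => [|n IH]; [exact: subring0|rewrite -natr1; exact: subringD subring1].
Qed.
Lemma subring_int m : H m%:~R.
Proof.
case: m => n; first exact: subring_nat.
by rewrite NegzE mulrNz; apply/subringN/subring_nat.
Qed.
Lemma subringMz x m : H x -> H (x *~ m).
Proof. by rewrite -mulrzr => Hx; apply: subringM (subring_int m). Qed.
Lemma subring_sum (I : Type) (r : seq I) (F : I -> R) :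
  (forall i, H (F i)) -> H (\sum_(i <- r) F i).
Proof. by move=> HF; elim/big_ind: _ => //; [exact: subring0|exact: subringD]. Qed.

End Subring.

Lemma scaleqz (a b : nat) (m : int) (x : quat a b) : (m%:~R : rat) *: x = x *~ m.
Proof. exact: scaler_int. Qed.

(** * Integrality of the norm on an order, and the link between [S_set] and principal ideals *)

Section Order.
Variables (a b : nat) (H : set (quat a b)) (e : 4.-tuple (quat a b)).
Hypotheses (hdiv : division_ring (quat a b)) (hR : is_subring H)
  (he : is_zbasis e H).
Implicit Types x y : quat a b.

Lemma order_den : exists2 D : nat, (0 < D)%N & forall x, H x ->
  [/\ D%:R * q0 x \is a Num.int, D%:R * q1 x \is a Num.int,
      D%:R * q2 x \is a Num.int & D%:R * q3 x \is a Num.int].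
Proof.
pose f (u : 'I_4 * 'I_4) : rat :=
  tnth [tuple q0 (tnth e u.1); q1 (tnth e u.1);
              q2 (tnth e u.1); q3 (tnth e u.1)] u.2.
have [D D_gt0 Df] := common_den f; exists D => // x.
case: he => -> _ [c ->].
have int_coord (q : quat a b -> rat) (s : 'I_4) :
    (forall x y, q (x + y) = q x + q y) -> (forall k x, q (k *: x) = k * q x) ->
    (forall i, q (tnth e i) = f (i, s)) -> D%:R * q (zcomb e c) \is a Num.int.
  move=> qD qZ qf.
  have -> : q (zcomb e c) = \sum_i (c i)%:~R * f (i, s).
    rewrite /zcomb (@big_morph _ _ q 0 +%R 0 +%R qD).
      by apply: eq_bigr => i _; rewrite -scaleqz qZ qf.
    by rewrite -(scale0r (0 : quat a b)) qZ mul0r.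
  rewrite mulr_sumr rpred_sum // => i _.
  by rewrite mulrCA rpredM ?intr_int.
split.
- exact: (int_coord _ (@Ordinal 4 0 isT)).
- exact: (int_coord _ (@Ordinal 4 1 isT)).
- exact: (int_coord _ (@Ordinal 4 2 isT)).
- exact: (int_coord _ (@Ordinal 4 3 isT)).
Qed.

(** Powers of x stay in H, so with D a common denominator of the coordinates on H, D^2 N(x)^n = N(D
    x^n) is an integer for every n. *)
Lemma order_norm_int x : H x -> qnorm x \is a Num.int.
Proof.
move=> Hx; have [D D_gt0 HD] := order_den.
apply: (@int_of_bounded_den (D ^ 2)); first by rewrite expn_gt0 D_gt0.
move=> n; have [i0 i1 i2 i3] := HD _ (subringX hR n Hx).
rewrite -qnormX natrX -qnormZ /qnorm /=.
by rewrite -natrM !rpredD ?(rpredM (natr_int _ _)) ?rpredX. 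
Qed.

Lemma order_norm_nat x : H x -> exists n : nat, qnorm x = n%:R.
Proof.
move=> Hx; have /intrP[m Nm] := order_norm_int Hx.
have : 0 <= qnorm x.
  have [->|x0] := eqVneq x 0; first by rewrite qnorm0.
  exact: ltW (qnorm_gt0 hdiv x0).
by rewrite Nm ler0z; case: m Nm => // n _ _; exists n.
Qed.

(** The conjugate is the trace minus x, and the trace is an integer. *)
Lemma order_conj x : H x -> H (qconj x).
Proof.
move=> Hx; rewrite qconjE; apply: (subringB hR) => //.
have /intrP[m ->] : 2 * q0 x \is a Num.int.
  rewrite qtrace_norm !rpredB ?rpred1 // order_norm_int //.
  exact: (subringD hR) (subring1 hR).
by rewrite scaleqz; exact: subring_int hR m.
Qed.

Lemma order_domain x y : x * y = 0 -> x = 0 \/ y = 0.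
Proof.
move=> xy0; have [->|x0] := eqVneq x 0; [by left | right].
by have [z [zx _]] := hdiv x0; rewrite -[y]mul1r -zx -mulrA xy0 mulr0.
Qed.

Lemma order_unscale (p : nat) d : (0 < p)%N ->
  H (p%:R^-1 *: zcomb e d) -> forall i, (p%:Z %| d i)%Z.
Proof.
move=> p_gt0; case: (he) => {1}-> _ [c Dc] i; apply/dvdzP; exists (c i).
apply: (zcomb_inj (d := fun i => c i * p%:Z) he).
rewrite zcombMz -Dc -scaleqz scalerA mulfV ?scale1r //.
by rewrite pnatr_eq0 -lt0n.
Qed.

(** Since al (h x - y) - be = (al h) x - (al y + be), witnesses for h x - y give witnesses for x.
    This allows x to be replaced by a convenient multiple or translate. *)
Lemma S_set_affine h y x : H h -> H y -> S_set H (h * x - y) -> S_set H x.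
Proof.
move=> Hh Hy [nHx [al [be [Hal Hbe D]]]]; split.
  by move=> Hx; apply: nHx; apply: (subringB hR) => //; apply: (subringM hR).
exists (al * h), (al * y + be); split.
- exact: subringM.
- by apply: (subringD hR) => //; apply: (subringM hR).
- by rewrite -mulrA opprD addrA -mulrBr.
Qed.

(** Let g generate H x + H p and write p = h g. Then g / p = al (x / p) - be has norm 1 / N(h),
    which is below 1 as soon as N(h) is not 1. *)
Lemma pid_S_set (p : nat) x : prime p -> left_pid H -> H x ->
  ~ H (p%:R^-1 *: x) -> S_set H (p%:R^-1 *: x).
Proof.
move=> pp [_ pid] Hx nHx; split => //.
have p0 : (p%:R : rat) != 0 by rewrite pnatr_eq0 -lt0n prime_gt0.
pose I := [set z | exists al be, [/\ H al, H be & z = al * x - be * p%:R]].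
have [] := pid I.
  split.
  - move=> _ [al [be [Hal Hbe ->]]].
    by apply: (subringB hR); apply: (subringM hR) => //; apply: subring_nat hR _.
  - by exists 0, 0; split; rewrite ?mul0r ?subrr //; exact: subring0 hR.
  - move=> _ _ [al [be [Hal Hbe ->]]] [al' [be' [Hal' Hbe' ->]]].
    exists (al - al'), (be - be'); split; try exact: (subringB hR).
    by rewrite !mulrBl !opprB [X in _ + X = _]addrC addrACA [X in _ + X = _]addrC.
  - move=> h _ Hh [al [be [Hal Hbe ->]]].
    exists (h * al), (h * be); split; try exact: (subringM hR).
    by rewrite mulrBr !mulrA.
move=> g Hg defI.
have [h Hh hg] : [set h * g | h in H] (p%:R : quat a b).
  rewrite -defI; exists 0, (-1); split; [exact: subring0 hR| |].
    exact: subringN (subring1 hR).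
  by rewrite mul0r mulN1r sub0r opprK.
have [k Hk kg] : [set h * g | h in H] x.
  rewrite -defI; exists 1, 0; split; [exact: subring1 hR|exact: subring0 hR|].
  by rewrite mul1r mul0r subr0.
have [al [be [Hal Hbe Dg]]] : I g.
  by rewrite defI; exists 1; [exact: subring1 hR|rewrite mul1r].
exists al, be; split => //.
have -> : al * (p%:R^-1 *: x) - be = p%:R^-1 *: g.
  rewrite Dg scalerBr -scalerAr; congr (_ - _).
  by rewrite mulr_natr -scaler_nat scalerA mulVf ?scale1r.
have Np : qnorm (p%:R : quat a b) = p%:R ^+ 2.
  by rewrite -[p%:R]scaler_nat qnormZ qnorm1 mulr1.
have := congr1 (@qnorm a b) hg; rewrite qnormM Np => Nhg.
have g0 : g != 0.
  apply: contra_eq_neq Nhg => ->; rewrite qnorm0 mulr0 eq_sym expf_eq0 /=.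
  exact: p0.
have h0 : h != 0.
  apply: contra_eq_neq Nhg => ->; rewrite qnorm0 mul0r eq_sym expf_eq0 /=.
  exact: p0.
have Ng := qnorm_gt0 hdiv g0; have Nh := qnorm_gt0 hdiv h0.
rewrite /D_set /= qnormZ.
have pp0 : (0 : rat) < p%:R by rewrite ltr0n prime_gt0.
have -> : p%:R^-1 ^+ 2 * qnorm g = (qnorm h)^-1.
  have ->: qnorm g = (p%:R ^+ 2) / qnorm h.
    by rewrite -Nhg mulrAC mulfV ?mul1r // gt_eqF.
  by rewrite mulrA -exprMn mulVf // expr1n mul1r.
rewrite invr_gt0 Nh invf_lt1 //.
have [n Nn] := order_norm_nat Hh; rewrite Nn in Nh *.
rewrite ltr0n in Nh; rewrite ltr1n ltn_neqAle Nh andbT eq_sym.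
(* If N(h) = 1 then g = conj(h) p, hence x = k g is a multiple of p. *)
apply/eqP => n1; apply: nHx; rewrite -kg.
have -> : g = p%:R *: qconj h.
  have := congr1 (fun z => qconj h * z) hg.
  by rewrite mulrA mul_conjq Nn n1 scale1r mul1r mulr_natr -scaler_nat => ->.
rewrite -scalerAr scalerA mulVf // scale1r.
by apply: (subringM hR) => //; apply: order_conj.
Qed.

(** A nonzero element g of least norm generates I: if x g^-1 were outside H, some al x g^-1 - be
    would have norm strictly between 0 and 1, so al x - be g would be a nonzero element of I of norm
    smaller than N(g). *)
Lemma dedekind_hasse : (forall x, ~ H x -> S_set H x) -> left_pid H.
Proof.
move=> hS; split; first by move=> x y _ _; apply: order_domain.
move=> I [IH I0 IB IM].
have [Inz|Iz] := pselect (exists2 x, I x & x != 0); last first.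
  exists 0; first exact: subring0 hR.
  apply/seteqP; split=> x; last by move=> [h _ <-]; rewrite mulr0.
  move=> Ix; exists 0; first exact: subring0 hR.
  rewrite mulr0; apply/esym/eqP; apply: contra_notT Iz => x0.
  by exists x.
pose P n := `[< exists x, [/\ I x, x != 0 & qnorm x = n%:R] >].
have exP : exists n, P n.
  case: Inz => x Ix x0; have [n Nx] := order_norm_nat (IH _ Ix).
  by exists n; apply/asboolP; exists x.
case: (ex_minnP exP) => n /asboolP[g [Ig g0 Ng]] min_n.
exists g; first exact: IH.
apply/seteqP; split=> x; last by move=> [h Hh <-]; exact: IM.
move=> Ix; have [y [yg gy]] := hdiv g0.
have [Hxy|/hS[_ [al [be [Hal Hbe /andP[D0 D1]]]]]] := pselect (H (x * y)).
  by exists (x * y) => //; rewrite -mulrA yg mulr1.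
pose z := al * x - be * g.
have Iz : I z by apply: IB; apply: IM.
have Nz : qnorm z = qnorm (al * (x * y) - be) * qnorm g.
  by rewrite -qnormM mulrBl -!mulrA yg mulr1.
have Ng_gt0 : 0 < qnorm g by apply: qnorm_gt0.
have z0 : z != 0.
  by apply: contraTneq D0 => z0; move: Nz; rewrite z0 qnorm0 => /esym/eqP;
     rewrite mulf_eq0 (gt_eqF Ng_gt0) orbF => /eqP->; rewrite ltxx.
have [m Nm] := order_norm_nat (IH _ Iz).
have /min_n : P m by apply/asboolP; exists z.
by rewrite leqNgt -(ltr_nat rat) -Nm -Ng Nz gtr_pMl // D1.
Qed.

End Order.

(** * Reduction to quotients delta / p with reduced coefficients *)

Section Reduction.
Variables (a b : nat) (H : set (quat a b)) (e : 4.-tuple (quat a b)).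
Hypotheses (hH : is_order H) (he : is_zbasis e H).
Implicit Types x y : quat a b.

Let hR : is_subring H. Proof. by case: hH. Qed.

Lemma order_rational x : exists2 n : nat, (0 < n)%N & H (n%:R *: x).
Proof.
case: hH => _ _ /(_ x)[m [h [c [Hh ->]]]].
have [D D_gt0 Dc] := common_den c; exists D => //.
rewrite scaler_sumr; apply: (subring_sum hR) => i.
have /intrP[k Dk] := Dc i; rewrite scalerA Dk scaleqz.
exact: subringMz hR _ _ (Hh i).
Qed.

(** With u p + w m = 1, taking alpha = w conj(x) and beta = -u gives alpha (x / p) - beta = (w m + u
    p) / p = 1 / p, of norm 1 / p^2. *)
Lemma S_set_coprime_norm (p : nat) x (m : int) : prime p -> H x ->
  ~ H (p%:R^-1 *: x) -> qnorm x = m%:~R -> ~~ (p%:Z %| m)%Z ->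
  S_set H (p%:R^-1 *: x).
Proof.
move=> pp Hx nHx Nx ndvd; split => //.
have p0 : (p%:R : rat) != 0 by rewrite pnatr_eq0 -lt0n prime_gt0.
have : coprimez p%:Z m.
  by rewrite coprimezE prime_coprime.
case/coprimezP => -[u w] /= uw.
exists ((w%:~R : rat) *: qconj x), ((- u)%:~R : quat a b); split.
- by rewrite scaleqz; apply: (subringMz hR); apply: (order_conj hR he).
- exact: subring_int hR _.
have -> : w%:~R *: qconj x * (p%:R^-1 *: x) - (- u)%:~R = (p%:R^-1 : rat)%:A.
  rewrite -scalerAl -scalerAr mul_conjq Nx -[(- u)%:~R]scaleqz !scalerA -scalerBl.
  congr (_ *: _); have /(congr1 (fun z : int => z%:~R : rat)) := uw.
  rewrite rmorphD !rmorphM rmorph1 /= -pmulrn => E.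
  by rewrite mulrNz opprK; apply: (mulfI p0); rewrite mulfV //= -[RHS]E; field.
rewrite /D_set /= qnormZ qnorm1 mulr1.
have p1 : (1 : rat) < p%:R by rewrite ltr1n prime_gt1.
have p_gt0 := lt_trans ltr01 p1.
by rewrite exprn_gt0 ?invr_gt0 // exprn_ilt1 ?invr_ge0 ?ler0n // invf_lt1.
Qed.

(** [B] singles out the primes treated by the explicit criterion. For these, a norm not divisible by
    p is settled by the Bezout argument, which leaves exactly the case assumed in the first
    premise. *)
Lemma S_set_reduction (B : nat -> Prop) :
  (forall p, prime p -> B p -> forall d : 'I_4 -> int,
     zcomb e d != 0 -> 0 <= d 0 ->
     (forall i, `|d i|%:~R <= p%:R / 2 :> rat) ->
     (exists m : int, qnorm (zcomb e d) = (p%:Z * m)%:~R) ->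
     S_set H (p%:R^-1 *: zcomb e d)) ->
  (forall p, prime p -> ~ B p -> forall d : 'I_4 -> int,
     ~ H (p%:R^-1 *: zcomb e d) -> S_set H (p%:R^-1 *: zcomb e d)) ->
  forall x, ~ H x -> S_set H x.
Proof.
move=> small large x nHx.
pose P n := (0 < n)%N && `[< H (n%:R *: x) >].
have exP : exists n, P n.
  by have [n n0 Hn] := order_rational x; exists n; rewrite /P n0; apply/asboolP.
(* By minimality of n, for a prime p dividing n the element y = (n / p) x lies outside H while p y
   lies in H. *)
case: (ex_minnP exP) => n /andP[n_gt0 /asboolP Hn] min_n.
have n_gt1 : (1 < n)%N.
  rewrite ltn_neqAle n_gt0 andbT; apply/eqP => n1; apply: nHx.
  by rewrite -n1 scale1r in Hn.
pose p := pdiv n; have pp : prime p by apply: pdiv_prime.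
have p_gt0 := prime_gt0 pp.
have p0 : (p%:R : rat) != 0 by rewrite pnatr_eq0 -lt0n.
have np : n = (n %/ p * p)%N by rewrite divnK // pdiv_dvd.
apply: (S_set_affine hR (subring_nat hR (n %/ p)) (subring0 hR)).
rewrite subr0 mulr_natl -scaler_nat.
set y := _ *: x.
have nHy : ~ H y.
  move=> Hy; have /min_n : P (n %/ p)%N.
    apply/andP; split; last exact/asboolP.
    by move: n_gt0; rewrite {1}np muln_gt0 => /andP[].
  by rewrite leqNgt ltn_Pdiv // prime_gt1.
have Hpy : H (p%:R *: y) by rewrite /y scalerA -natrM mulnC -np.
case: (he) => defH _; move: (Hpy); rewrite {1}defH => -[d Dd].
(* Subtracting the nearest multiples of p from the coefficients translates y by an element of H and
   leaves coefficients of size at most p / 2. *)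
have [f Df] := choice (fun i => nearest_multiple (d i) p_gt0).
pose d' i := d i - f i * p%:Z.
have Hf : H (zcomb e f) by rewrite defH; exists f.
apply: (S_set_affine hR (subring1 hR) Hf); rewrite mul1r.
have Dy : y - zcomb e f = p%:R^-1 *: zcomb e d'.
  rewrite zcombB zcombMz -Dd -scaleqz -pmulrn scalerBr !scalerA mulVf //.
  by rewrite !mul1r !scale1r.
rewrite Dy.
(* Multiplication by a sign s makes the coefficient of 1 nonnegative. *)
have [s [Hs s2 sd0]] : exists s : int, [/\ H s%:~R, s * s = 1 & 0 <= s * d' 0].
  have [d0|d0] := leP 0 (d' 0).
    by exists 1; split; rewrite ?mul1r //; exact: subring_int hR _.
  by exists (-1); split; rewrite ?mulN1r ?oppr_ge0 ?ltW ?opprK //;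
    exact: subring_int hR _.
apply: (S_set_affine hR Hs (subring0 hR)); rewrite subr0.
pose d2 i := d' i * s.
have Dd2 : s%:~R * (p%:R^-1 *: zcomb e d') = p%:R^-1 *: zcomb e d2.
  by rewrite mulrzl scalerMzr -zcombMz.
rewrite Dd2.
have nH2 : ~ H (p%:R^-1 *: zcomb e d2).
  rewrite -Dd2 => /(subringM hR Hs); rewrite mulrA -intrM s2 mul1r => H'.
  by apply: nHy; rewrite -(subrK (zcomb e f) y) Dy; apply: (subringD hR).
have [Bp|nBp] := pselect (B p); last exact: large.
have H2 : H (zcomb e d2) by rewrite defH; exists d2.
have /intrP[m Nm] := order_norm_int hR he H2.
have [/dvdzP[k mk]|ndvd] := boolP (p%:Z %| m)%Z; last first.
  exact: (S_set_coprime_norm pp H2 nH2 Nm).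
apply: small => //.
- apply: contra_notN nH2 => /eqP->; rewrite scaler0; exact: subring0 hR.
- by rewrite /d2 mulrC.
- move=> i; rewrite ler_pdivlMr ?ltr0n // -[2]/(2%:~R) -intrM.
  rewrite -[p%:R]/(p%:~R) ler_int /d2 normrM.
  suff -> : `|s| = 1 by rewrite mulr1; apply: Df.
  apply/eqP; rewrite -(@pexpr_eq1 _ _ 2) // -normrX expr2 s2.
  by rewrite normr1.
- by exists k; rewrite Nm mk mulrC.
Qed.

End Reduction.

(** * Numerical estimates behind the bound on p *)

Lemma le_max_coef m n (c : 'M[rat]_(m, n)) r s : `|c r s| <= max_coef c.
Proof.
apply: le_trans (le_bigmax _ (fun r => \big[Order.max/0]_s `|c r s|) r).
exact: (le_bigmax _ (fun s => `|c r s|)).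
Qed.

(** The left side of the hypothesis is the larger root of K^2 - 4 m K - 12 d m^2; completing the
    square gives (K - 2 m)^2 >= 4 m^2 (1 + 3 d). *)
Lemma sqrt_quadratic_bound (R : rcfType) (m K : R) (d : nat) : 0 < m ->
  2 * m * (1 + Num.sqrt (1 + 3 * d%:R)) <= K ->
  0 < K /\ 12 * d%:R * m ^+ 2 + 4 * m * K <= K ^+ 2.
Proof.
move=> m_gt0; set s := Num.sqrt _ => sK.
have s_ge0 : 0 <= s by apply: sqrtr_ge0.
have s2 : s ^+ 2 = 1 + 3 * d%:R by rewrite sqr_sqrtr // addr_ge0 ?mulr_ge0.
have ms_ge0 : 0 <= 2 * m * s by rewrite !mulr_ge0 // ltW.
split; first by lra.
have : (2 * m * s) ^+ 2 <= (K - 2 * m) ^+ 2 by rewrite ler_sqr ?nnegrE; lra.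
by rewrite exprMn s2; lra.
Qed.

(** The square root has disappeared from the conclusion, so the inequality descends from [realalg]
    to the rationals. *)
Lemma ceil_quadratic_bound (M : rat) (d : nat) (k : int) : 0 < M ->
  k = Num.ceil (2 * ratr M * (1 + Num.sqrt (1 + 3 * d%:R)) : realalg) ->
  0 < k /\ 12 * d%:R * M ^+ 2 + 4 * M * k%:~R <= k%:~R ^+ 2.
Proof.
move=> M_gt0; set X := 2 * _ * _ => ->.
have m_gt0 : 0 < (ratr M : realalg) by rewrite ltr0q.
have [] := sqrt_quadratic_bound (d := d) m_gt0 (ceil_ge X).
rewrite ltr0z => -> le_sq.
split=> //; rewrite -(ler_rat realalg) rmorphD rmorphXn !rmorphM /=.
by rewrite !ratr_int !ratr_nat.
Qed.

(** With d = (1 + a)(1 + b), the bounds give K^2 N(x) < (K / 2 + 3 M)^2 + 9 M^2 (a + b + a b) = K^2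
    / 4 + 3 M K + 9 d M^2. The last two terms are 3 / 4 of the left side of the final hypothesis, so
    the total is at most K^2. *)
Lemma qnorm_lt1 (a b : nat) (x : quat a b) (M K z0 z1 z2 z3 u : rat) :
  0 < K -> q0 x = u + z0 -> q1 x = z1 -> q2 x = z2 -> q3 x = z3 ->
  `|u| <= 1 / 2 ->
  `|K * z0| < 3 * M -> `|K * z1| < 3 * M ->
  `|K * z2| < 3 * M -> `|K * z3| < 3 * M ->
  12 * ((1 + a) * (1 + b))%:R * M ^+ 2 + 4 * M * K <= K ^+ 2 ->
  qnorm x < 1.
Proof.
move=> K_gt0 E0 E1 E2 E3 hu h0 h1 h2 h3 hK.
have K2_gt0 : 0 < K ^+ 2 by apply: exprn_gt0.
rewrite -(ltr_pM2l K2_gt0) mulr1.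
have M_gt0 : 0 < M by have := le_lt_trans (normr_ge0 _) h0; lra.
have sq z : `|z| < 3 * M -> z ^+ 2 <= (3 * M) ^+ 2.
  by move=> hz; rewrite -real_normK ?num_real // ler_sqr ?nnegrE //; lra.
have S0 : (K * q0 x) ^+ 2 < (K / 2 + 3 * M) ^+ 2.
  rewrite -real_normK ?num_real // ltr_sqr ?nnegrE //; last by lra.
  rewrite E0 mulrDr (le_lt_trans (ler_normD _ _)) // ler_ltD //.
  by rewrite normrM gtr0_norm // ler_pM2l //; lra.
have /(ler_wpM2l (ler0n rat a)) S1 := sq _ h1.
have /(ler_wpM2l (ler0n rat b)) S2 := sq _ h2.
have /(ler_wpM2l (ler0n rat (a * b))) S3 := sq _ h3.
move: S0 S1 S2 S3 hK; rewrite /qnorm -E1 -E2 -E3 !natrM !natrD.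
move: (a%:R) (b%:R) => A B.
lra.
Qed.

(** * Primes above the bound *)

Section LargePrimes.
Variables (a b : nat) (H : set (quat a b)) (c : 'M[rat]_(3, 4))
  (v : 'I_3 -> quat a b).
Hypotheses (hdiv : division_ring (quat a b)) (hR : is_subring H).
Hypothesis (hv : forall r : 'I_3,
  v r = (c r 0)%:A + c r 1 *: qi + c r 2 *: qj + c r 3 *: qk).
Let e := [tuple 1; v 0; v 1; v 2].
Hypothesis (he : is_zbasis e H).

Lemma zcomb1E d :
  zcomb e d = (d 0)%:~R + \sum_(r < 3) v r *~ d (lift ord0 r).
Proof.
rewrite /zcomb big_ord_recl; congr (_ + _); apply: eq_bigr => r _.
congr (_ *~ _); case: r => [[|[|[|//]]] hr]; rewrite (tnth_nth 0) /=;
  by congr v; apply: val_inj.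
Qed.

(** If all coefficients vanished, [v 0] would be zero, against the independence of the basis. *)
Lemma max_coef_gt0 : 0 < max_coef c.
Proof.
rewrite ltNge; apply/negP => M0.
have c0 s : c 0 s = 0.
  apply/eqP; rewrite -normr_eq0 eq_le normr_ge0 andbT.
  exact: le_trans (le_max_coef c 0 s) M0.
have v0 : v 0 = 0 by rewrite hv !c0 !scale0r !addr0.
have [_ /(_ (fun i => (i == lift ord0 (0 : 'I_3))%:Z))] := he.
move=> /(_ _ (lift ord0 0)); rewrite eqxx => free.
suff /free : zcomb e (fun i => (i == lift ord0 (0 : 'I_3))%:Z) = 0 by [].
rewrite zcomb1E add0r big1 // => r _.
by have [/lift_inj ->|] := eqVneq; rewrite ?v0 ?mul0rz.
Qed.

(** The coefficient of the basis element 1 enters the real coordinate only, so rounding it to within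
    1 / 2 is enough. *)
Lemma zcomb1_coords (h : 'I_4 -> int) (k : rat)
    (z := fun s => \sum_(r < 3) k * (h (lift ord0 r))%:~R * c r s) :
  k *: zcomb e h = Quat _ _ (k * (h 0)%:~R + z 0) (z 1) (z 2) (z 3).
Proof.
rewrite zcomb1E /z !big_ord_recl !big_ord0 -!scaleqz !hv.
by congr Quat => /=; ring.
Qed.

Lemma S_set_large_prime (p : nat) d : prime p ->
  prime_bound (max_coef c) ((1 + a) * (1 + b)) <= p%:Z ->
  ~ H (p%:R^-1 *: zcomb e d) -> S_set H (p%:R^-1 *: zcomb e d).
Proof.
rewrite /prime_bound; set k := Num.ceil _ => pp kp nHx; split => //.
have [k_gt0 hk] := ceil_quadratic_bound max_coef_gt0 (erefl k).
move: k_gt0 hk kp; case: k => // K K_gt0 hK.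
rewrite -rmorphXn /= => Kp.
(* A prime is not a cube, so the inequality is strict; then t <= K^3 < p makes t prime to p. *)
have {Kp} Kp : (K ^ 3 < p)%N.
  rewrite ltn_neqAle; apply/andP; split; last by move: Kp; lia.
  apply/eqP => Kp3; have /primeP[p1 /(_ K)] := pp.
  by rewrite -Kp3 dvdn_exp // => /(_ isT) /orP[] /eqP; nia.
have p_gt0 := prime_gt0 pp.
have p0 : (p%:R : rat) != 0 by rewrite pnatr_eq0 -lt0n.
have pr_gt0 : (0 : rat) < p%:R by rewrite ltr0n.
(* Only the three coefficients of the v_r are approximated simultaneously; the coefficient of 1 is
   then rounded for the resulting t. *)
have [t [t_gt0 tK [q hq]]] :=
  simultaneous_approximation (fun r : 'I_3 => d (lift ord0 r)) K_gt0 p_gt0.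
have [w hw] := nearest_multiple (t%:Z * d 0) p_gt0.
pose g i := if unlift ord0 i is Some r then q r else w.
pose h i := d i * t%:Z - g i * p%:Z.
have h0 : `|h 0| * 2 <= p%:Z by rewrite /h /g unlift_none [d 0 * _]mulrC.
have hS r : K%:Z * `|h (lift ord0 r)| < p%:Z.
  by rewrite /h /g liftK [d _ * _]mulrC.
have Dx : t%:R * (p%:R^-1 *: zcomb e d) - zcomb e g = p%:R^-1 *: zcomb e h.
  rewrite zcombB !zcombMz -!scaleqz -!pmulrn scalerBr !scalerA mulVf // scale1r.
  by rewrite mulr_natl -scaler_nat scalerA mulrC.
exists t%:R, (zcomb e g); split; [exact: subring_nat hR t| |].
  by case: he => -> _; exists g.
rewrite Dx; apply/andP; split.
  (* If the translate vanished, p would divide every t d_i, hence every d_i, and the original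
     quotient would lie in H. *)
  apply: (qnorm_gt0 hdiv); apply: contra_notN nHx => /eqP h_0.
  have {}h_0 i : h i = 0.
    apply: (proj2 he); apply: (scalerI (a := p%:R^-1)); first by rewrite invr_eq0.
    by rewrite h_0 scaler0.
  have dvd i : d i = (d i %/ p%:Z)%Z * p%:Z.
    rewrite divzK // -(@Gauss_dvdzl _ _ t%:Z).
      by apply/dvdzP; exists (g i); apply/eqP; rewrite -subr_eq0 -[_ - _]/(h i) h_0.
    rewrite coprimezE /= prime_coprime // gtnNdvd //.
    exact: leq_ltn_trans tK Kp.
  case: he => -> _; exists (fun i => (d i %/ p%:Z)%Z).
  rewrite (_ : zcomb e d = zcomb e (fun i => (d i %/ p%:Z)%Z * p%:Z)).
    by rewrite zcombMz -scaleqz -pmulrn scalerA mulVf // scale1r.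
  by apply: eq_bigr => i _; rewrite -dvd.
have Kr_gt0 : (0 : rat) < K%:R by rewrite ltr0n.
have M_gt0 := max_coef_gt0.
(* Each of the three summands is below M in absolute value, because K |h_r| / p < 1 and the
   coefficients are at most M. *)
have small s : `|K%:R * \sum_(r < 3) p%:R^-1 * (h (lift ord0 r))%:~R * c r s|
    < 3 * max_coef c.
  have term r : `|K%:R * (p%:R^-1 * (h (lift ord0 r))%:~R * c r s)| < max_coef c.
    rewrite mulrA normrM.
    apply: le_lt_trans (ler_wpM2l (normr_ge0 _) (le_max_coef c r s)) _.
    rewrite gtr_pMl // mulrCA normrM gtr0_norm ?invr_gt0 // mulrC ltr_pdivrMr //.
    rewrite mul1r normrM gtr0_norm // -intr_norm.
    by have := hS r; rewrite -(ltr_int rat) intrM.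
  rewrite !big_ord_recl big_ord0 !mulrDr mulr0 addr0.
  have -> : 3 * max_coef c = max_coef c + (max_coef c + max_coef c) by ring.
  apply: le_lt_trans (ler_normD _ _) _; apply: ltrD => //.
  by apply: le_lt_trans (ler_normD _ _) _; apply: ltrD.
rewrite zcomb1_coords; apply: (qnorm_lt1 (u := p%:R^-1 * (h 0)%:~R)
  (K := K%:R) (M := max_coef c)) => //=.
rewrite normrM gtr0_norm ?invr_gt0 // mulrC ler_pdivrMr // -intr_norm.
move: h0; rewrite -(ler_int rat) intrM -[p%:~R]/(p%:R).
by lra.
Qed.
End LargePrimes.

Theorem theorem4p6 (a b : nat) (H : set (quat a b))
    (c : 'M[rat]_(3, 4)) (v : 'I_3 -> quat a b)
    (hdiv : division_ring (quat a b))
    (hH : is_order H)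
    (hv : forall r : 'I_3,
       v r = (c r 0)%:A + c r 1 *: qi + c r 2 *: qj + c r 3 *: qk)
    (hbasis : is_zbasis [tuple 1; v 0; v 1; v 2] H) :
  left_pid H <->
  (forall p : nat, prime p ->
     p%:Z < prime_bound (max_coef c) ((1 + a) * (1 + b))%N ->
   forall d : 'I_4 -> int,
     let delta := zcomb [tuple 1; v 0; v 1; v 2] d in
     delta != 0 ->
     0 <= d 0 ->
     (forall i, `|d i|%:~R <= p%:R / 2 :> rat) ->
     (exists m : int, qnorm delta = (p%:Z * m)%:~R) ->
     S_set H (p%:R^-1 *: delta)).
Proof.
have hR : is_subring H by case: hH.
split=> [pid p pp _ d delta delta0 _ d_le _ | small].
  apply: (pid_S_set hdiv hR hbasis pp pid).
    by case: hbasis => -> _; exists d.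
  (* If delta / p were in H, p would divide every d_i; with |d_i| <= p / 2 this forces delta = 0. *)
  move=> /(order_unscale hbasis (prime_gt0 pp)) dvd.
  case/eqP: delta0; apply: big1 => i _.
  suff -> : d i = 0 by rewrite mulr0z.
  have := d_le i; rewrite ler_pdivlMr // -[2]/(2%:~R) -intrM.
  rewrite -[p%:R]/(p%:~R) ler_int; case/dvdzP: (dvd i) => q ->.
  have [->|q0] := eqVneq q 0; first by rewrite mul0r.
  have q_ge1 : 1 <= `|q| by lia.
  by have := prime_gt0 pp; rewrite normrM; nia.
apply: (dedekind_hasse hdiv hR hbasis).
apply: (S_set_reduction hH hbasis
  (B := fun p => p%:Z < prime_bound (max_coef c) ((1 + a) * (1 + b))%N)).
  by move=> p pp pB d; apply: small.
move=> p pp /negP pB d; apply: (S_set_large_prime hdiv hR hv hbasis) => //.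
by rewrite leNgt.
Qed.
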